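(* For every Turing machine $\mathcal{T}$, the variety $\mathcal{V}(\mathbb{A}(\mathcal{T}))$ generated by the algebra $\mathbb{A}(\mathcal{T})$ does not have bounded Maltsev depth.
   Context: **Turing machines.** A Turing machine $\mathcal{T}$ is a finite list of 5-tuples $(s,r,w,d,t)$, called instructions (read: ''if in state $s$ and reading $r$, write $w$, move direction $d$, enter state $t$''), with a finite set of states $\{\mu_0,\ldots,\mu_m\}$ ($\mu_1$ initial, $\mu_0$ halting), $r,w\in\{0,1\}$, $d\in\{\text{L},\text{R}\}$. **The algebra $\mathbb{A}(\mathcal{T})$.** Let $U=\{1,2,\text{H}\}$, $W=\{C,D,\partial C,\partial D\}$, $A=\{0\}\cup U\cup W$; $V_{ir}^s=\{C_{ir}^s,D_{ir}^s,M_i^r,\partial C_{ir}^s,\partial D_{ir}^s,\partial M_i^r\}$ for $0\le i\le m$, $r,s\in\{0,1\}$; $V_{ir}=V_{ir}^0\cup V_{ir}^1$, $V_i=V_{i0}\cup V_{i1}$, $V=\bigcup_{0\le i\le m}V_i$. All displayed symbols are distinct. The universe is $A(\mathcal{T})=A\cup V$. Here $\partial$ is a permutation of order 2 with domain $V\cup W$ ($\partial\partial x=x$); it is not an operation of the algebra, and a condition such as $x=\partial y$ holds only for $y\in V\cup W$. The fundamental operations are as follows. The constant $0$. Meet: $x\wedge y=x$ if $x=y$, and $0$ otherwise (a height 1 semilattice with bottom $0$; below $\vee$ denotes join in the associated order, $x\le y$ iff $x\in\{0,y\}$). Multiplication: $2\cdot D=\text{H}\cdot C=D$, $1\cdot C=C$,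 $2\cdot\partial D=\text{H}\cdot\partial C=\partial D$, $1\cdot\partial C=\partial C$, and $x\cdot y=0$ otherwise. $J(x,y,z)=x$ if $x=y$; $=x\wedge z$ if $x=\partial y$; $=0$ otherwise. $J'(x,y,z)=x\wedge z$ if $x=y$; $=x$ if $x=\partial y$; $=0$ otherwise. $S_0(u,x,y,z)=(x\wedge y)\vee(x\wedge z)$ if $u\in V_0$, and $0$ otherwise. $S_1(u,x,y,z)=(x\wedge y)\vee(x\wedge z)$ if $u\in\{1,2\}$, and $0$ otherwise. $S_2(u,v,x,y,z)=(x\wedge y)\vee(x\wedge z)$ if $u=\partial v\in V\cup W$, and $0$ otherwise. $T(w,x,y,z)=w\cdot x$ if $w\cdot x=y\cdot z$ and $(w,x)=(y,z)$; $=\partial(w\cdot x)$ if $w\cdot x=y\cdot z\ne0$ and $(w,x)\ne(y,z)$; $=0$ otherwise. $I(1)=C_{10}^0$, $I(\text{H})=M_1^0$, $I(2)=D_{10}^0$, and $I(x)=0$ otherwise. For each instruction $(\mu_i,r,s,\text{L},\mu_j)$ of $\mathcal{T}$ and each $t\in\{0,1\}$, an operation $L_{irt}(x,y,u)$ equal to: $C_{jt}^{s'}$ if $x=y=1$ and $u=C_{ir}^{s'}$ for some $s'$; $M_j^t$ if $x=\text{H}$, $y=1$, $u=C_{ir}^t$; $D_{jt}^s$ if $x=2$, $y=\text{H}$, $u=M_i^r$; $D_{jt}^{s'}$ if $x=y=2$ and $u=D_{ir}^{s'}$ for some $s'$; $\partial v$ if $u\in V$ and $L_{irt}(x,y,\partial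 u)=v\in V$ by the preceding clauses; $0$ otherwise. $\mathcal{L}$ is the set of these operations. For each instruction $(\mu_i,r,s,\text{R},\mu_j)$ and each $t\in\{0,1\}$, an operation $R_{irt}(x,y,u)$ equal to: $C_{jt}^{s'}$ if $x=y=1$ and $u=C_{ir}^{s'}$ for some $s'$; $C_{jt}^s$ if $x=\text{H}$, $y=1$, $u=M_i^r$; $M_j^t$ if $x=2$, $y=\text{H}$, $u=D_{ir}^t$; $D_{jt}^{s'}$ if $x=y=2$ and $u=D_{ir}^{s'}$ for some $s'$; $\partial v$ if $u\in V$ and $R_{irt}(x,y,\partial u)=v\in V$ by the preceding clauses; $0$ otherwise. $\mathcal{R}$ is the set of these operations. Define $\prec$ on $\{1,2,\text{H}\}$ by $2\prec2$, $2\prec\text{H}$, $\text{H}\prec1$, $1\prec1$ (and no other pairs). For each $F\in\mathcal{L}\cup\mathcal{R}$: $U_F^1(x,y,z,u)=\partial F(x,y,u)$ if $x\prec z$, $y\ne z$, $F(x,y,u)\ne0$; $=F(x,y,u)$ if $x\prec z$, $y=z$, $F(x,y,u)\ne0$; $=0$ otherwise. $U_F^0(x,y,z,u)=\partial F(y,z,u)$ if $x\prec z$, $x\ne y$, $F(y,z,u)\ne0$; $=F(y,z,u)$ if $x\prec z$, $x=y$, $F(y,z,u)\ne0$; $=0$ otherwise. The operations of $\mathbb{A}(\mathcal{T})$ are $\{0,\wedge,(\cdot),J,J',S_0,S_1,S_2,T,I\}\cup\mathcal{L}\cup\mathcal{R}\cup\{U_F^1,U_F^0\mid F\in\mathcal{L}\cup\mathcal{R}\}$.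 **Bounded Maltsev depth.** $\text{Cg}^{\mathbb{A}}(a,b)$ denotes the principal congruence of $\mathbb{A}$ generated by $(a,b)$. A fundamental translation of an algebra is a unary polynomial obtained from a fundamental operation by fixing all but one variable (to elements of the algebra). Let $M$ be a natural number. A class $\mathcal{C}$ of algebras of the same type has Maltsev depth $M$ if for every $\mathbb{A}\in\mathcal{C}$ and every $a,b,c,d\in A$ with $(c,d)\in\text{Cg}^{\mathbb{A}}(a,b)$ there are elements $c=r_1,r_2,\ldots,r_n=d$ and unary polynomials $\lambda_1(x),\ldots,\lambda_{n-1}(x)$ such that $\{\lambda_i(a),\lambda_i(b)\}=\{r_i,r_{i+1}\}$ and each $\lambda_i(x)$ is compositionally generated by at most $M$ fundamental translations (i.e. is a composition of at most $M$ of them), and $M$ is minimal with this property. The class $\mathcal{C}$ is of bounded Maltsev depth if there is some $M$ such that $\mathcal{C}$ has Maltsev depth $M$. *)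

(* Defs.v *)
From HB Require Import structures.
From mathcomp Require Import all_boot.

Set Implicit Arguments.
Unset Strict Implicit.
Unset Printing Implicit Defensive.

Record signature := Signature { symbol : Type; arity : symbol -> nat }.

Record algebra (Sg : signature) := Algebra {
  carrier :> Type;
  interp : forall f : symbol Sg, (arity f).-tuple carrier -> carrier }.

Arguments Algebra {Sg}.
Arguments interp {Sg} _ _ _.

Section UniversalAlgebra.
Variable Sg : signature.
Implicit Types (A B : algebra Sg) (K : algebra Sg -> Prop).

Definition homomorphism A B (h : A -> B) : Prop :=
  forall (f : symbol Sg) (t : (arity f).-tuple A),
    h (interp A f t) = interp B f (map_tuple h t).

Definition prod_algebra (X : Type) (F : X -> algebra Sg) : algebra Sg :=
  Algebra (forall x, F x)
    (fun f t x => interp (F x) f (map_tuple (fun a : forall x, F x => a x) t)).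

Definition closed_under_images K : Prop :=
  forall A B (h : A -> B),
    homomorphism h -> (forall b, exists a, h a = b) -> K A -> K B.

(* Subalgebras are taken up to isomorphism, as embedded algebras; together
   with closure under images this is the usual closure under subalgebras. *)
Definition closed_under_subalgebras K : Prop :=
  forall A B (h : A -> B), homomorphism h -> injective h -> K B -> K A.

Definition closed_under_products K : Prop :=
  forall (X : Type) (F : X -> algebra Sg),
    (forall x, K (F x)) -> K (prod_algebra F).

Definition variety K : Prop :=
  [/\ closed_under_images K, closed_under_subalgebras K
    & closed_under_products K].

Definition generated_variety A : algebra Sg -> Prop :=
  fun B => forall K, variety K -> K A -> K B.

Definition congruence A (R : A -> A -> Prop) : Prop :=
  [/\ forall x, R x x,
      forall x y, R x y -> R y x,
      forall x y z, R x y -> R y z -> R x z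
    & forall (f : symbol Sg) (s t : (arity f).-tuple A),
        (forall i, R (tnth s i) (tnth t i)) ->
        R (interp A f s) (interp A f t)].

Definition Cg A (a b c d : A) : Prop :=
  forall R : A -> A -> Prop, congruence R -> R a b -> R c d.

(* The [i]-th component of [p] is irrelevant: it is replaced by the variable. *)
Definition fundamental_translation A (g : A -> A) : Prop :=
  exists (f : symbol Sg) (i : 'I_(arity f)) (p : (arity f).-tuple A),
    forall x, g x = interp A f [tuple if j == i then x else tnth p j | j < arity f].

(* The empty composition, i.e. the identity, is allowed. *)
Inductive translation_comp A : nat -> (A -> A) -> Prop :=
| translation_comp0 g : (forall x, g x = x) -> translation_comp 0 g
| translation_compS n g h k :
    fundamental_translation g -> translation_comp n h ->
    (forall x, k x = g (h x)) -> translation_comp n.+1 k.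

Definition same_pair (X : Type) (x y z w : X) : Prop :=
  (x = z /\ y = w) \/ (x = w /\ y = z).

(* The depth condition, without the minimality of [M]. *)
Definition maltsev_depth_within K (M : nat) : Prop :=
  forall A, K A -> forall a b c d : A, Cg a b c d ->
    exists (n : nat) (r : nat -> A) (lam : nat -> A -> A),
      [/\ r 0 = c, r n = d
        & forall i, i < n ->
            (exists2 k, k <= M & translation_comp k (lam i))
            /\ same_pair (lam i a) (lam i b) (r i) (r i.+1)].

Definition has_maltsev_depth K (M : nat) : Prop :=
  maltsev_depth_within K M
  /\ forall M', maltsev_depth_within K M' -> M <= M'.

Definition bounded_maltsev_depth K : Prop :=
  exists M, has_maltsev_depth K M.

End UniversalAlgebra.

Fixpoint nfun (n : nat) (X : Type) : Type :=
  if n is n'.+1 then X -> nfun n' X else X.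

Fixpoint napp (X : Type) (n : nat) : nfun n X -> n.-tuple X -> X :=
  if n is n'.+1 then fun f t => napp (f (thead t)) (behead_tuple t)
  else fun c _ => c.

(* Tape symbols 0, 1 are [false], [true].  The states mu_0, ..., mu_m are the
   elements of ['I_m.+1], with [m = n.+1] since mu_0 and mu_1 always exist. *)

Inductive direction := Left | Right.

Record instruction (n : nat) := Instruction {
  in_state : 'I_n.+2;
  in_read : bool;
  in_write : bool;
  in_dir : direction;
  in_next : 'I_n.+2 }.

Record turing_machine := TuringMachine {
  tm_n : nat;
  tm_prog : seq (instruction tm_n) }.

Definition mu0 n : 'I_n.+2 := ord0.
Definition mu1 n : 'I_n.+2 := @Ordinal n.+2 1 isT.

(* [VC i r s], [VD i r s], [VM i r] are C_{ir}^s, D_{ir}^s, M_i^r. *)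
Inductive letter (n : nat) :=
| WC | WD
| VC of 'I_n.+2 & bool & bool
| VD of 'I_n.+2 & bool & bool
| VM of 'I_n.+2 & bool.

Arguments WC {n}.
Arguments WD {n}.

(* [Ltr false v] is [v] itself and [Ltr true v] is its partner under the
   involution [pd]. *)
Inductive elt (n : nat) :=
| Zero | One | Two | Hd
| Ltr of bool & letter n.

Arguments Zero {n}.
Arguments One {n}.
Arguments Two {n}.
Arguments Hd {n}.

Section Elements.
Variable n : nat.

Definition letter_eqb (v w : letter n) : bool :=
  match v, w with
  | WC, WC | WD, WD => true
  | VC i r s, VC j r' s' | VD i r s, VD j r' s' =>
      [&& i == j, r == r' & s == s']
  | VM i r, VM j r' => (i == j) && (r == r')
  | _, _ => false
  end.

Lemma letter_eqP : Equality.axiom letter_eqb.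
Proof.
case=> [||i r s|i r s|i r] [||j r' s'|j r' s'|j r'] /=; try by constructor.
- by apply: (iffP and3P) => [[/eqP-> /eqP-> /eqP->]|[-> -> ->]].
- by apply: (iffP and3P) => [[/eqP-> /eqP-> /eqP->]|[-> -> ->]].
- by apply: (iffP andP) => [[/eqP-> /eqP->]|[-> ->]].
Qed.

HB.instance Definition _ := hasDecEq.Build (letter n) letter_eqP.

Definition elt_eqb (x y : elt n) : bool :=
  match x, y with
  | Zero, Zero | One, One | Two, Two | Hd, Hd => true
  | Ltr b v, Ltr c w => (b == c) && (v == w)
  | _, _ => false
  end.

Lemma elt_eqP : Equality.axiom elt_eqb.
Proof.
case=> [||||b v] [||||c w] /=; try by constructor.
by apply: (iffP andP) => [[/eqP-> /eqP->]|[-> ->]].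
Qed.

HB.instance Definition _ := hasDecEq.Build (elt n) elt_eqP.

Implicit Types x y z u v w : elt n.

Definition in_VW x : bool := if x is Ltr _ _ then true else false.

Definition in_V0 x : bool :=
  match x with
  | Ltr _ (VC i _ _) | Ltr _ (VD i _ _) | Ltr _ (VM i _) => i == mu0 n
  | _ => false
  end.

(* Meaningful on V and W only; the identity elsewhere. *)
Definition pd x : elt n := if x is Ltr b v then Ltr (~~ b) v else x.

(* The condition "x = pd y", which includes that y is in V or W. *)
Definition is_pd x y : bool := in_VW y && (x == pd y).

Definition emeet x y : elt n := if x == y then x else Zero.

(* Only used on elements having a common upper bound. *)
Definition ejoin x y : elt n := if x == Zero then y else x.

Definition emul x y : elt n :=
  match x, y with
  | Two, Ltr b WD => Ltr b WD
  | Hd, Ltr b WC => Ltr b WD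
  | One, Ltr b WC => Ltr b WC
  | _, _ => Zero
  end.

Definition eJ x y z : elt n :=
  if x == y then x else if is_pd x y then emeet x z else Zero.

Definition eJ' x y z : elt n :=
  if x == y then emeet x z else if is_pd x y then x else Zero.

Definition eS0 u x y z : elt n :=
  if in_V0 u then ejoin (emeet x y) (emeet x z) else Zero.

Definition eS1 u x y z : elt n :=
  if (u == One) || (u == Two) then ejoin (emeet x y) (emeet x z) else Zero.

Definition eS2 u v x y z : elt n :=
  if is_pd u v then ejoin (emeet x y) (emeet x z) else Zero.

Definition eT w x y z : elt n :=
  if (emul w x == emul y z) && ((w, x) == (y, z)) then emul w x
  else if (emul w x == emul y z) && (emul w x != Zero) then pd (emul w x)
  else Zero.

Definition eI x : elt n :=
  match x with
  | One => Ltr false (VC (mu1 n) false false)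
  | Hd => Ltr false (VM (mu1 n) false)
  | Two => Ltr false (VD (mu1 n) false false)
  | _ => Zero
  end.

(* The operation L_{irt} or R_{irt} of an instruction.  The clause defining it
   on the [pd]-partners says that it commutes with [pd] in [u]; hence the
   flag [b] is passed from [u] to the result. *)
Definition eF (ins : instruction n) (t : bool) x y u : elt n :=
  let: Instruction i r s d j := ins in
  match d with
  | Left =>
    match x, y, u with
    | One, One, Ltr b (VC i' r' s') =>
        if (i' == i) && (r' == r) then Ltr b (VC j t s') else Zero
    | Hd, One, Ltr b (VC i' r' s') =>
        if [&& i' == i, r' == r & s' == t] then Ltr b (VM j t) else Zero
    | Two, Hd, Ltr b (VM i' r') =>
        if (i' == i) && (r' == r) then Ltr b (VD j t s) else Zero
    | Two, Two, Ltr b (VD i' r' s') =>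
        if (i' == i) && (r' == r) then Ltr b (VD j t s') else Zero
    | _, _, _ => Zero
    end
  | Right =>
    match x, y, u with
    | One, One, Ltr b (VC i' r' s') =>
        if (i' == i) && (r' == r) then Ltr b (VC j t s') else Zero
    | Hd, One, Ltr b (VM i' r') =>
        if (i' == i) && (r' == r) then Ltr b (VC j t s) else Zero
    | Two, Hd, Ltr b (VD i' r' s') =>
        if [&& i' == i, r' == r & s' == t] then Ltr b (VM j t) else Zero
    | Two, Two, Ltr b (VD i' r' s') =>
        if (i' == i) && (r' == r) then Ltr b (VD j t s') else Zero
    | _, _, _ => Zero
    end
  end.

Definition prec x y : bool :=
  match x, y with
  | Two, Two | Two, Hd | Hd, One | One, One => true
  | _, _ => false
  end.

Definition eU1 (F : elt n -> elt n -> elt n -> elt n) x y z u : elt n :=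
  if prec x z && (F x y u != Zero) then
    if y == z then F x y u else pd (F x y u)
  else Zero.

Definition eU0 (F : elt n -> elt n -> elt n -> elt n) x y z u : elt n :=
  if prec x z && (F y z u != Zero) then
    if x == y then F y z u else pd (F y z u)
  else Zero.

End Elements.

Section AT.
Variable T : turing_machine.

(* The last three families are indexed by the positions [k] of instructions in
   the program and by [t]; [oF k t] is in L or R according to the direction of
   the instruction. *)
Inductive at_symbol :=
| o0 | oMeet | oMul | oJ | oJ' | oS0 | oS1 | oS2 | oT | oI
| oF of 'I_(size (tm_prog T)) & bool
| oU1 of 'I_(size (tm_prog T)) & bool
| oU0 of 'I_(size (tm_prog T)) & bool.

Definition at_arity (f : at_symbol) : nat :=
  match f with
  | o0 => 0
  | oI => 1
  | oMeet | oMul => 2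
  | oJ | oJ' | oF _ _ => 3
  | oS0 | oS1 | oT | oU1 _ _ | oU0 _ _ => 4
  | oS2 => 5
  end.

Definition at_signature : signature := Signature at_arity.

Definition at_instr (k : 'I_(size (tm_prog T))) : instruction (tm_n T) :=
  tnth (in_tuple (tm_prog T)) k.

Definition at_op (f : at_symbol) : nfun (at_arity f) (elt (tm_n T)) :=
  match f return nfun (at_arity f) (elt (tm_n T)) with
  | o0 => Zero
  | oMeet => @emeet _
  | oMul => @emul _
  | oJ => @eJ _
  | oJ' => @eJ' _
  | oS0 => @eS0 _
  | oS1 => @eS1 _
  | oS2 => @eS2 _
  | oT => @eT _
  | oI => @eI _
  | oF k t => eF (at_instr k) t
  | oU1 k t => eU1 (eF (at_instr k) t)
  | oU0 k t => eU0 (eF (at_instr k) t)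
  end.

Definition AT : algebra at_signature :=
  @Algebra at_signature (elt (tm_n T)) (fun f => napp (at_op f)).

End AT.

(* Main.v *)
(* Write [p_i = (D, ..., D, C, ..., C; C)] with [i] letters [D] among [n]
   coordinates, followed by one further coordinate, here indexed by [None], and
   let [q_i] be [p_i] with its last [D] replaced by [pd D].  In the algebra of
   all elements of [A(T)^(n+1)] below some [p_i] or [q_i], [J'(p_i, q_i, _)]
   agrees with the meet with [p_i] except at the last [D] of [p_i], which it
   supplies by itself; so it maps [p_(i-1)] to [p_i].  Hence, with [x'] denoting
   [x] with [None] set to [0], (p_n, p_n') lies in Cg(p_0, p_0').  Conversely,
   only meet, [J] and [J'] can be nonzero at [None], and if their value has [k]
   initial coordinates in [{D, pd D}] and is nonzero at [None], then so, with
   [k - 1] for [k], does each argument on which the coordinate [None] of the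
   value depends.  Thus one translation gains at most one [D], and no composition
   of fewer than [n] translations links [p_n] to anything else. *)
Require Import Defs.
From mathcomp Require Import all_boot.

Set Implicit Arguments.
Unset Strict Implicit.
Unset Printing Implicit Defensive.

(** * The operations of A(T) on 0 and W *)

Definition zero_or_W (n : nat) (v : elt n) : bool :=
  if v is (Zero | Ltr _ WC | Ltr _ WD) then true else false.

Section ZeroOrW.
Variable n : nat.
Implicit Types u v w x y : elt n.

Lemma emul_W x y : zero_or_W x -> emul x y = Zero.
Proof. by case: x. Qed.

Lemma eF_W ins b x y u : zero_or_W x -> @eF n ins b x y u = Zero.
Proof. by case: ins => i r s [] j; case: x. Qed.

Lemma emeet_le x y : emeet x y = Zero \/ emeet x y = x.
Proof. by rewrite /emeet; case: eqP; auto. Qed.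

Lemma ejoin_emeet_le x y z :
  ejoin (emeet x y) (emeet x z) = Zero \/ ejoin (emeet x y) (emeet x z) = x.
Proof. by rewrite /ejoin; case: eqP => _; apply: emeet_le. Qed.

End ZeroOrW.

Ltac split_tuple t :=
  repeat (let x := fresh "x" in case/tupleP: t => x t).

(** The index [i] is chosen before the tuple, so in a power one and the same argument bounds the
    value at every coordinate; this makes the elements below the rungs a subalgebra. Apart from the
    constant, the vanishing operations need an entry among [One], [Two], [Hd]. *)
Lemma at_op_le_arg (T : turing_machine) (f : at_symbol T) :
  (forall t : (at_arity f).-tuple (elt (tm_n T)),
     all (@zero_or_W _) t -> napp (at_op f) t = Zero)
  \/ exists i : 'I_(at_arity f), forall t : (at_arity f).-tuple (elt (tm_n T)),
     napp (at_op f) t = Zero \/ napp (at_op f) t = tnth t i.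
Proof.
case: f => [||||||||||k b|k b|k b].
- by left=> t _.
- right; exists (@Ordinal 2 0 isT) => t; split_tuple t; exact: emeet_le.
- by left=> t; split_tuple t; case/and3P=> Wx _ _; apply: emul_W.
- right; exists (@Ordinal 3 0 isT) => t; split_tuple t.
  rewrite /= !theadE /eJ; case: ifP => _; first by right.
  by case: ifP => _; [apply: emeet_le | left].
- right; exists (@Ordinal 3 0 isT) => t; split_tuple t.
  rewrite /= !theadE /eJ'; case: ifP => _; first exact: emeet_le.
  by case: ifP => _; [right | left].
- right; exists (@Ordinal 4 1 isT) => t; split_tuple t.
  by rewrite /= !theadE /eS0; case: ifP => _; [apply: ejoin_emeet_le | left].
- right; exists (@Ordinal 4 1 isT) => t; split_tuple t.
  by rewrite /= !theadE /eS1; case: ifP => _; [apply: ejoin_emeet_le | left].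
- right; exists (@Ordinal 5 2 isT) => t; split_tuple t.
  by rewrite /= !theadE /eS2; case: ifP => _; [apply: ejoin_emeet_le | left].
- left=> t; split_tuple t; case/and5P=> Wx _ _ _ _.
  by rewrite /= !theadE /eT emul_W // eqxx andbF; case: ifP.
- by left=> t; split_tuple t; rewrite /= theadE; case: x.
- by left=> t; split_tuple t; case/and4P=> Wx _ _ _; apply: eF_W.
- left=> t; split_tuple t; case/and5P=> Wx _ _ _ _.
  by rewrite /= !theadE /eU1 eF_W // eqxx andbF.
- left=> t; split_tuple t; case/and5P=> _ Wx _ _ _.
  by rewrite /= !theadE /eU0 eF_W // eqxx andbF.
Qed.

Lemma thead_map_tuple (A B : Type) (g : A -> B) m (t : m.+1.-tuple A) :
  thead (map_tuple g t) = g (thead t).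
Proof. exact: tnth_map. Qed.

Lemma behead_map_tuple (A B : Type) (g : A -> B) m (t : m.+1.-tuple A) :
  behead_tuple (map_tuple g t) = map_tuple g (behead_tuple t).
Proof. by apply: val_inj; rewrite /= behead_map. Qed.

Lemma tnth_lift0 (A : Type) m (t : m.+1.-tuple A) i :
  tnth t (lift ord0 i) = tnth (behead_tuple t) i.
Proof. by case/tupleP: t => x t; rewrite !(tnth_nth x). Qed.

Definition map_tupleE := (behead_map_tuple, thead_map_tuple).

(** * The ladder, a member of the generated variety *)

Section Ladder.
Variables (T : turing_machine) (n : nat).
Local Notation E := (elt (tm_n T)).
Local Notation X := (option 'I_n).
Local Notation C := (Ltr false WC).

Definition power : algebra (at_signature T) := prod_algebra (fun _ : X => AT T).
Implicit Types (x y z : power) (j : X).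

Definition rung (i : nat) (s : bool) : power := fun j =>
  if j is Some j then
    if j < i then Ltr (s && (j.+1 == i)) WD else C
  else C.

(** Boolean, so that membership proofs are unique and [val] is injective on [ladder_carrier]. *)
Definition below_rung x : bool :=
  [exists i : 'I_n.+1, exists s, forall j, (x j == Zero) || (x j == rung i s j)].

Lemma below_rungP x :
  reflect (exists (i : 'I_n.+1) s, forall j, x j = Zero \/ x j = rung i s j)
          (below_rung x).
Proof.
apply: (iffP existsP) => -[i].
  case/existsP=> s /forallP xi; exists i, s => j.
  by case/orP: (xi j) => /eqP; [left | right].
case=> s xi; exists i; apply/existsP; exists s; apply/forallP => j.
by case: (xi j) => ->; rewrite eqxx ?orbT.
Qed.

Lemma below_rung_W x j : below_rung x -> zero_or_W (x j).
Proof.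
move=> /below_rungP[i [s /(_ j)[]->]] //.
by case: j => [j|] //=; case: ifP.
Qed.

Lemma below_rung_None x : below_rung x -> x None = Zero \/ x None = C.
Proof. by move=> /below_rungP[i [s /(_ None)]]. Qed.

Definition ladder_carrier := {x : power | below_rung x}.

Lemma below_rung_interp (f : at_symbol T) (t : (at_arity f).-tuple ladder_carrier) :
  below_rung (interp power f (map_tuple val t)).
Proof.
apply/below_rungP; case: (at_op_le_arg f) => [op0 | [i op_le]].
  exists ord0, false => j; left; apply: op0.
  apply/all_tnthP => i; rewrite !tnth_map; exact: below_rung_W (valP (tnth t i)).
case/below_rungP: (valP (tnth t i)) => k [s tik]; exists k, s => j.
case: (op_le (map_tuple (fun x : power => x j) (map_tuple val t))) => /= ->.
  by left.
rewrite !tnth_map; exact: tik.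
Qed.

Definition ladder : algebra (at_signature T) :=
  @Algebra (at_signature T) ladder_carrier
    (fun f t => exist _ (interp power f (map_tuple val t)) (below_rung_interp t)).

Lemma ladder_generated : generated_variety (AT T) ladder.
Proof.
move=> K [_ subK prodK] KT.
have := @prodK X (fun=> AT T) (fun=> KT).
by apply: (subK _ _ (val : ladder -> power)) => //; apply: val_inj.
Qed.

(** * Height of an element and its loss under translations *)

Definition coord (p : ladder) j : E := val p j.

Lemma coord_interp f (t : (at_arity f).-tuple ladder) j :
  coord (interp ladder f t) j = napp (at_op f) (map_tuple (coord^~ j) t).
Proof.
by rewrite {1}/coord /=; congr (napp _ _); apply: eq_from_tnth => i; rewrite !tnth_map.
Qed.

(** Both signs of [WD] are allowed because the first two arguments of [eJ] and [eJ'] may be partners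
    where the value is nonzero. *)
Definition climbed (k : nat) (p : ladder) : Prop :=
  coord p None = C /\ forall j : 'I_n, j < k -> exists b, coord p (Some j) = Ltr b WD.

(* [D] cannot be [pd D] below [k.-1]: only [q_k] has [pd D] among its first [k]
   coordinates while reaching the height [k], and then in the last of them. *)
Lemma climbed_D k p (j : 'I_n) :
  k <= n -> climbed k p -> j < k.-1 -> coord p (Some j) = Ltr false WD.
Proof.
case: k => //= k lt_kn [_ Dp] lt_jk.
case/below_rungP: (valP p) => i [s le_p].
have coordE (l : 'I_n) : l <= k -> coord p (Some l) = rung i s (Some l).
  by move=> lk; case: (le_p (Some l)) => // p0; case: (Dp l lk) => b; rewrite /coord p0.
have lt_j1n : j.+1 < n by apply: leq_ltn_trans lt_kn.
have := Dp (Ordinal lt_j1n) lt_jk.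
rewrite !coordE ?(ltnW lt_jk) //= => -[b].
case: ifP => // lt_j1i _.
by rewrite (ltnW lt_j1i) (ltn_eqF lt_j1i) andbF.
Qed.

Lemma coord_None p : coord p None = Zero \/ coord p None = C.
Proof. exact: below_rung_None (valP p). Qed.

Lemma climbed_pred k p : climbed k p -> climbed k.-1 p.
Proof.
by move=> [pN Dp]; split=> // j jk; apply: Dp; apply: leq_trans jk (leq_pred k).
Qed.

Lemma climbed_eq_or_pd k p q :
  climbed k p ->
  (forall j, coord p j != Zero ->
     coord q j = coord p j \/ is_pd (coord p j) (coord q j)) ->
  climbed k q.
Proof.
move=> [pN Dp] pq; split=> [|j jk].
  have := pq None; rewrite pN => /(_ isT)[] //.
  (* In the ladder the coordinate [None] is never the partner of [C]. *)
  by case: (coord_None q) => ->.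
case: (Dp j jk) => b pj; have := pq (Some j); rewrite pj => /(_ isT)[->|].
  by exists b.
by case: (coord q (Some j)) => // c l /andP[_ /eqP[_ <-]]; exists c.
Qed.

Lemma climbed_le k p q :
  climbed k p -> (forall j, coord p j = Zero \/ coord p j = coord q j) -> climbed k q.
Proof.
move=> cp pq; apply: (climbed_eq_or_pd cp) => j; case: (pq j) => [->|->] //; by left.
Qed.

Lemma climbed_interp k (f : at_symbol T) (s t : (at_arity f).-tuple ladder) :
  k <= n -> climbed k (interp ladder f s) -> coord (interp ladder f t) None = Zero ->
  exists i, climbed k.-1 (tnth s i) /\ coord (tnth t i) None = Zero.
Proof.
move=> kn cs; have [sN _] := cs; rewrite !coord_interp in sN *.
have W p : zero_or_W (coord p None) := below_rung_W None (valP p).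
case: f s t cs sN => [||||||||||l b|l b|l b] s t cs //=; rewrite ?map_tupleE => sN tN.
- have cs0 : climbed k (thead s).
    apply: (climbed_le cs) => j; rewrite coord_interp /= !map_tupleE; exact: emeet_le.
  have cs1 : climbed k (thead (behead_tuple s)).
    apply: (climbed_le cs) => j; rewrite coord_interp /= !map_tupleE /emeet.
    by case: eqP; auto.
  case: (coord_None (thead t)) tN => t0N.
    by exists ord0; split=> //; apply: climbed_pred.
  case: (coord_None (thead (behead_tuple t))) => t1N; last by rewrite t0N t1N.
  by exists (lift ord0 ord0); rewrite !tnth_lift0; split=> //; apply: climbed_pred.
- by rewrite emul_W in sN.
- have cs0 : climbed k (thead s).
    apply: (climbed_le cs) => j; rewrite coord_interp /= !map_tupleE /eJ.
    case: ifP => _; first by right.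
    by case: ifP => _; [apply: emeet_le | left].
  have cs1 : climbed k (thead (behead_tuple s)).
    apply: (climbed_eq_or_pd cs) => j; rewrite coord_interp /= !map_tupleE /eJ.
    case: ifP => [/eqP<-|_]; first by left.
    by case: ifP => // st; rewrite /emeet; case: ifP => // _ _; right.
  case: (coord_None (thead t)) tN => t0N.
    by exists ord0; split=> //; apply: climbed_pred.
  (* When its first two arguments agree, [eJ] ignores the third, so one of these two must be
     [Zero]. *)
  case: (coord_None (thead (behead_tuple t))) => t1N; last by rewrite /eJ t0N t1N.
  by exists (lift ord0 ord0); rewrite !tnth_lift0; split=> //; apply: climbed_pred.
- have cs0 : climbed k (thead s).
    apply: (climbed_le cs) => j; rewrite coord_interp /= !map_tupleE /eJ'.
    case: ifP => _; first exact: emeet_le.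
    by case: ifP => _; [right | left].
  have cs1 : climbed k (thead (behead_tuple s)).
    apply: (climbed_eq_or_pd cs) => j; rewrite coord_interp /= !map_tupleE /eJ'.
    case: ifP => [/eqP<-|_]; first by rewrite /emeet; case: ifP => //; left.
    by case: ifP => // st _; right.
  (* Below [k.-1] the first two arguments are both D itself, so [eJ'] is a meet there and forces D
     in the third. At [k.-1] they may be partners, which leaves the third free: this is the only
     loss of height. *)
  have cs2 : climbed k.-1 (thead (behead_tuple (behead_tuple s))).
    split=> [|j jk].
      move: sN; rewrite /eJ' (proj1 cs0) (proj1 cs1) eqxx /emeet.
      by case: eqP.
    have [_ /(_ j (leq_trans jk (leq_pred k)))[b]] := cs.
    rewrite coord_interp /= !map_tupleE /eJ' (climbed_D kn cs0 jk) (climbed_D kn cs1 jk).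
    rewrite eqxx /emeet.
    by case: eqP => // <- _; exists false.
  case: (coord_None (thead t)) tN => t0N.
    by exists ord0; split=> //; apply: climbed_pred.
  case: (coord_None (thead (behead_tuple t))) => t1N.
    by exists (lift ord0 ord0); rewrite !tnth_lift0; split=> //; apply: climbed_pred.
  case: (coord_None (thead (behead_tuple (behead_tuple t)))) => t2N.
    by exists (lift ord0 (lift ord0 ord0)); rewrite !tnth_lift0; split.
  by rewrite /eJ' t0N t1N t2N.
(* At [None] only [Zero] and [C] occur: neither is in V_0 or U, and no two of them are partners. *)
- by move: sN; rewrite /eS0; case: (coord_None (thead s)) => ->.
- by move: sN; rewrite /eS1; case: (coord_None (thead s)) => ->.
- move: sN; rewrite /eS2; case: (coord_None (thead s)) => ->;
    by case: (coord_None (thead (behead_tuple s))) => ->.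
- by move: sN; rewrite /eT emul_W // eqxx andbF; case: ifP.
- by move: sN; case: (coord_None (thead s)) => ->.
- by rewrite eF_W in sN.
- by rewrite /eU1 eF_W // eqxx andbF in sN.
- by rewrite /eU0 eF_W // eqxx andbF in sN.
Qed.

Lemma translation_coord (g : ladder -> ladder) m p q j :
  translation_comp m g -> coord p j = coord q j -> coord (g p) j = coord (g q) j.
Proof.
move=> comp_g pq; elim: comp_g => [h hE | {}m h1 h2 h [f [i [r h1E]]] _ IH hE].
  by rewrite !hE.
rewrite !hE !h1E !coord_interp; congr (napp _ _); apply: eq_from_tnth => l.
by rewrite !tnth_map !tnth_ord_tuple; case: ifP.
Qed.

Lemma translation_climbed (g : ladder -> ladder) m k p q :
  translation_comp m g -> k <= n -> climbed k (g p) -> coord (g q) None = Zero ->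
  climbed (k - m) p /\ coord q None = Zero.
Proof.
move=> comp_g; elim: comp_g k => [h hE | {}m h1 h2 h [f [i [r h1E]]] _ IH hE] k kn.
  by rewrite !hE subn0.
rewrite !hE !h1E => cp /(climbed_interp kn cp)[l].
(* A fixed argument would be both [C] and [Zero] at [None], so the argument found is the one
   carrying the variable. *)
rewrite !tnth_mktuple; case: ifP => [_ [cp2 q2]|_ [[-> _]]] //.
by have := IH k.-1 (leq_trans (leq_pred k) kn) cp2 q2; rewrite -subn1 -subnDA add1n.
Qed.

(** * Climbing the ladder by polynomials *)

Lemma rung_below (i : 'I_n.+1) s : below_rung (rung i s).
Proof. by apply/below_rungP; exists i, s; right. Qed.

(** Above [n], [inord] falls back to 0; hence the bound in [coord_rungL]. *)
Definition rungL (i : nat) (s : bool) : ladder :=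
  exist (fun x => below_rung x) _ (rung_below (inord i) s).

Lemma coord_rungL i s j : i <= n -> coord (rungL i s) j = rung i s j.
Proof. by move=> ni; rewrite /coord /= inordK. Qed.

Definition foot0 : power := fun j => if j is Some _ then C else Zero.

Lemma foot0_below : below_rung foot0.
Proof.
by apply/below_rungP; exists ord0, false => -[j|]; [right | left].
Qed.

Definition foot0L : ladder := exist (fun x => below_rung x) _ foot0_below.

Definition climb (i : nat) (p : ladder) : ladder :=
  interp ladder (oJ' T) [tuple rungL i.+1 false; rungL i.+1 true; p].

Lemma coord_climb i p j : i < n ->
  coord (climb i p) j = eJ' (rung i.+1 false j) (rung i.+1 true j) (coord p j).
Proof. by move=> lt_in; rewrite coord_interp -!coord_rungL. Qed.

Lemma iter_climb_rung i j : i <= n ->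
  coord (iteri i climb (rungL 0 false)) j = rung i false j.
Proof.
elim: i => [|i IH] lt_in /=; first exact: coord_rungL.
rewrite coord_climb // IH ?(ltnW lt_in) //.
case: j {IH} => [j|] //=; rewrite eqSS !ltnS.
(* At [j = i] the two rungs are partners and [eJ'] returns D unaided; elsewhere they agree and it is
   a meet. *)
by case: (ltngtP j i).
Qed.

Lemma iter_climb_foot0 i : i <= n -> coord (iteri i climb foot0L) None = Zero.
Proof. by elim: i => [|i IH] lt_in //=; rewrite coord_climb // IH ?(ltnW lt_in). Qed.

Lemma Cg_iter_climb i :
  Cg (rungL 0 false) foot0L
     (iteri i climb (rungL 0 false)) (iteri i climb foot0L).
Proof.
move=> R [Rrefl _ _ Rop] Rab; elim: i => //= i IH.
by apply: Rop => -[[|[|[|l]]] //= ltl3]; rewrite !(tnth_nth (rungL 0 false)).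
Qed.

(** * The lower bound on the depth *)

Lemma ladder_deep M : M < n ->
  ~ maltsev_depth_within (generated_variety (AT T)) M.
Proof.
move=> lt_Mn /(_ _ ladder_generated _ _ _ _ (Cg_iter_climb n))[N [r [lam [r0 rN link]]]].
(* Invariant along the chain, violated at its end, which is [Zero] at [None]. *)
suff climb_r i : i <= N -> climbed n (r i).
  by have [] := climb_r N (leqnn N); rewrite rN iter_climb_foot0.
elim: i => [_|i IH lt_iN].
  rewrite r0; split=> [|j lt_jn]; rewrite iter_climb_rung //=.
  by rewrite lt_jn; exists false.
have {}IH := IH (ltnW lt_iN).
have [[m le_mM comp_lam] lam_ab] := link i lt_iN.
have lt_0nm : 0 < n - m by rewrite subn_gt0 (leq_ltn_trans le_mM).
have n_gt0 : 0 < n by apply: leq_ltn_trans lt_Mn.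
have step p q : same_pair p q (rungL 0 false) foot0L -> lam i p = r i ->
    lam i q = r i.+1 -> climbed n (r i.+1).
  (* If [None] dropped to [Zero], a generator would be climbed to the positive height [n - m]; but
     [foot0L] is [Zero] at [None], and [rungL 0 false] contains no [WD]. *)
  move=> pq pi qi; case: (coord_None (r i.+1)) => rN1.
    rewrite -pi in IH; rewrite -qi in rN1.
    have [[pN Dp] qN] := translation_climbed comp_lam (leqnn n) IH rN1.
    case: pq => -[pE qE]; last by rewrite pE in pN.
    by have [b] := Dp (Ordinal n_gt0) lt_0nm; rewrite pE coord_rungL.
  (* The generators differ only at [None], so the other coordinates are the same in both links. *)
  split=> // j lt_jn; case: IH => _ /(_ j lt_jn); rewrite -pi -qi.
  rewrite (@translation_coord _ _ q p (Some j) comp_lam) //.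
  by case: pq => -[-> ->]; rewrite coord_rungL.
case: lam_ab => -[ai bi]; [apply: (step _ _ _ ai bi) | apply: (step _ _ _ bi ai)].
  by left.
by right.
Qed.
End Ladder.

Theorem theorem3p11 (T : turing_machine) :
  ~ bounded_maltsev_depth (generated_variety (AT T)).
(* The ladder with [n = M.+1] refutes depth [M]. *)
Proof. by case=> M [depthM _]; apply: (ladder_deep (ltnSn M) depthM). Qed.
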